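(* Let $\mathcal A$ be a finitely complete category. The following are equivalent. (1) $\mathcal A$ is propointed and protomodular. (2) $\mathcal A$ is propointed and the slice category $\mathcal A/0$ is protomodular. (3) There exists a conservative right-adjoint functor $U\colon\mathcal A\to\mathcal X$ with $\mathcal X$ finitely complete, pointed and protomodular. (4) $\mathcal A$ admits an initial object and there exists a left-exact conservative functor $U\colon\mathcal A\to\mathcal X$ with $\mathcal X$ finitely complete, pointed and protomodular.
   Context: A finitely complete category is propointed if it admits an initial object $0$ and the unique morphism $0\to1$ is a universal extremal epimorphism (an extremal epimorphism all of whose pullbacks are extremal epimorphisms). Protomodular is meant in the sense of Bourn: a finitely complete category is protomodular if for every morphism $v\colon Y\to X$ the pullback functor from the category of points over $X$ (split epimorphisms with codomain $X$ together with a chosen section) to the category of points over $Y$ is conservative. A category is pointed if it has a zero object. A functor is right-adjoint if it admits a left adjoint, conservative if it reflects isomorphisms, left-exact if it preserves finite limits. *)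

(* Defs.v *)
From Stdlib Require Import ClassicalEpsilon List.
From Stdlib Require FinFun.

Set Implicit Arguments.
Unset Strict Implicit.
Unset Printing Implicit Defensive.

(* Morphisms are compared with Leibniz equality; objects of all categories
   below live in one fixed universe and morphisms in another, not larger. *)
Record category := Category {
  ob :> Type;
  hom : ob -> ob -> Type;
  idm : forall X, hom X X;
  comp : forall X Y Z, hom Y Z -> hom X Y -> hom X Z;
  comp_id_l : forall X Y (f : hom X Y), comp (idm Y) f = f;
  comp_id_r : forall X Y (f : hom X Y), comp f (idm X) = f;
  comp_assoc : forall W X Y Z (h : hom Y Z) (g : hom X Y) (f : hom W X),
    comp h (comp g f) = comp (comp h g) f
}.

Arguments hom {c} X Y.
Arguments idm {c} X.
Arguments comp {c X Y Z} g f : rename.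

Declare Scope cat_scope.
Delimit Scope cat_scope with cat.
Open Scope cat_scope.
Notation "g ∘ f" := (comp g f) (at level 40, left associativity) : cat_scope.

Record functor (C D : category) := Functor {
  fob :> C -> D;
  fmap : forall X Y, hom X Y -> hom (fob X) (fob Y);
  fmap_id : forall X, fmap (idm X) = idm (fob X);
  fmap_comp : forall X Y Z (g : hom Y Z) (f : hom X Y),
    fmap (g ∘ f) = fmap g ∘ fmap f
}.

Arguments fmap {C D} f {X Y} _ : rename.

Program Definition functor_comp (B C D : category) (G : functor C D)
    (F : functor B C) : functor B D :=
  @Functor B D (fun X => G (F X)) (fun X Y f => fmap G (fmap F f)) _ _.
Next Obligation. now rewrite !fmap_id. Qed.
Next Obligation. now rewrite !fmap_comp. Qed.

Definition is_iso (C : category) (X Y : C) (f : hom X Y) : Prop :=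
  exists g : hom Y X, g ∘ f = idm X /\ f ∘ g = idm Y.

Definition is_mono (C : category) (X Y : C) (f : hom X Y) : Prop :=
  forall (W : C) (g h : hom W X), f ∘ g = f ∘ h -> g = h.

Definition is_epi (C : category) (X Y : C) (f : hom X Y) : Prop :=
  forall (Z : C) (g h : hom Y Z), g ∘ f = h ∘ f -> g = h.

Definition is_initial (C : category) (Z : C) : Prop :=
  forall X : C, exists! f : hom Z X, True.

Definition is_terminal (C : category) (T : C) : Prop :=
  forall X : C, exists! f : hom X T, True.

Definition has_initial (C : category) : Prop := exists Z : C, is_initial Z.

Definition pointed (C : category) : Prop :=
  exists Z : C, is_initial Z /\ is_terminal Z.

Definition conservative (C D : category) (F : functor C D) : Prop :=
  forall (X Y : C) (f : hom X Y), is_iso (fmap F f) -> is_iso f.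

Record adjunction (C D : category) (L : functor C D) (R : functor D C) := {
  unit_at : forall X : C, hom X (R (L X));
  counit_at : forall A : D, hom (L (R A)) A;
  unit_natural : forall (X Y : C) (f : hom X Y),
    unit_at Y ∘ f = fmap R (fmap L f) ∘ unit_at X;
  counit_natural : forall (A B : D) (g : hom A B),
    counit_at B ∘ fmap L (fmap R g) = g ∘ counit_at A;
  triangle_left : forall X : C,
    counit_at (L X) ∘ fmap L (unit_at X) = idm (L X);
  triangle_right : forall A : D,
    fmap R (counit_at A) ∘ unit_at (R A) = idm (R A)
}.

Definition right_adjoint (C D : category) (R : functor D C) : Prop :=
  exists L : functor C D, inhabited (adjunction L R).

(** * Finite limits *)

Definition finite_category (J : category) : Prop :=
  FinFun.Finite J /\ forall i j : J, FinFun.Finite (hom i j).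

Record cone (J C : category) (D : functor J C) := Cone {
  apex : C;
  leg : forall j : J, hom apex (D j);
  leg_natural : forall (i j : J) (a : hom i j), fmap D a ∘ leg i = leg j
}.

Arguments leg {J C D} c j.

Definition is_limit (J C : category) (D : functor J C) (c : cone D) : Prop :=
  forall c' : cone D,
    exists! u : hom (apex c') (apex c), forall j : J, leg c j ∘ u = leg c' j.

Program Definition map_cone (J C E : category) (F : functor C E)
    (D : functor J C) (c : cone D) : cone (functor_comp F D) :=
  @Cone J E (functor_comp F D) (F (apex c)) (fun j => fmap F (leg c j)) _.
Next Obligation. now rewrite <- fmap_comp, leg_natural. Qed.

Definition finitely_complete (C : category) : Prop :=
  forall J : category, finite_category J ->
  forall D : functor J C, exists c : cone D, is_limit c.

Definition left_exact (C E : category) (F : functor C E) : Prop :=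
  forall J : category, finite_category J ->
  forall (D : functor J C) (c : cone D),
    is_limit c -> is_limit (map_cone F c).

(** * Pullbacks *)

Definition is_pullback (C : category) (X Y Z P : C)
    (f : hom X Z) (g : hom Y Z) (p : hom P X) (q : hom P Y) : Prop :=
  f ∘ p = g ∘ q /\
  forall (Q : C) (x : hom Q X) (y : hom Q Y), f ∘ x = g ∘ y ->
    exists! u : hom Q P, p ∘ u = x /\ q ∘ u = y.

Record pullback (C : category) (X Y Z : C) (f : hom X Z) (g : hom Y Z) := {
  pb_ob : C;
  pb_fst : hom pb_ob X;
  pb_snd : hom pb_ob Y;
  pb_spec : is_pullback f g pb_fst pb_snd
}.

Arguments pb_ob {C X Y Z f g} p.
Arguments pb_fst {C X Y Z f g} p.
Arguments pb_snd {C X Y Z f g} p.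

Inductive cospan_ob : Set := cs_left | cs_right | cs_base.

Definition cospan_hom (i j : cospan_ob) : Set :=
  match i, j with
  | cs_left, cs_left | cs_right, cs_right | cs_base, cs_base
  | cs_left, cs_base | cs_right, cs_base => unit
  | _, _ => Empty_set
  end.

Definition cospan_id (i : cospan_ob) : cospan_hom i i :=
  match i with cs_left | cs_right | cs_base => tt end.

Definition cospan_comp (i j k : cospan_ob) :
  cospan_hom j k -> cospan_hom i j -> cospan_hom i k.
Proof.
destruct i, j, k; simpl; intros b a;
  solve [exact tt | destruct a | destruct b].
Defined.

Lemma cospan_thin (i j : cospan_ob) (a b : cospan_hom i j) : a = b.
Proof. destruct i, j; simpl in a, b; now destruct a, b. Qed.

Definition cospan_category : category :=
  @Category cospan_ob cospan_hom cospan_id cospan_comp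
    (fun _ _ _ => cospan_thin _ _) (fun _ _ _ => cospan_thin _ _)
    (fun _ _ _ _ _ _ _ => cospan_thin _ _).

Lemma finite_cospan : finite_category cospan_category.
Proof.
split.
- exists (cs_left :: cs_right :: cs_base :: nil); intros i.
  destruct i; simpl; tauto.
- intros i j; destruct i, j; simpl;
    solve [exists (tt :: nil); intros []; now left | exists nil; intros []].
Qed.

Section CospanDiagram.
Variables (C : category) (X Y Z : C) (f : hom X Z) (g : hom Y Z).

Definition cospan_fob (i : cospan_category) : C :=
  match i with cs_left => X | cs_right => Y | cs_base => Z end.

Definition cospan_fmap (i j : cospan_category) :
  @hom cospan_category i j -> hom (cospan_fob i) (cospan_fob j).
Proof.
destruct i, j; simpl; intros a;
  solve [exact (idm _) | exact f | exact g | destruct a].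
Defined.

Definition cospan_functor : functor cospan_category C.
Proof.
refine (@Functor cospan_category C cospan_fob cospan_fmap _ _).
- intros i; now destruct i.
- intros i j k b a; destruct i, j, k; simpl in a, b |- *;
    solve [destruct a | destruct b
          | now rewrite comp_id_l | now rewrite comp_id_r].
Defined.

Lemma finitely_complete_pullback :
  finitely_complete C -> inhabited (pullback f g).
Proof.
intros HC; destruct (HC _ finite_cospan cospan_functor) as [c Hc].
pose (p := leg c cs_left : hom (apex c) X).
pose (q := leg c cs_right : hom (apex c) Y).
pose (r := leg c cs_base : hom (apex c) Z).
assert (Hp : f ∘ p = r)
  by exact (@leg_natural _ _ _ c cs_left cs_base tt).
assert (Hq : g ∘ q = r)
  by exact (@leg_natural _ _ _ c cs_right cs_base tt).
constructor; exists (apex c) p q; split; [congruence|].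
intros Q x y E.
pose (l := fun i : cospan_category =>
  match i return hom Q (cospan_functor i) with
  | cs_left => x | cs_right => y | cs_base => f ∘ x end).
assert (Hl : forall (i j : cospan_category) (a : hom i j),
  fmap cospan_functor a ∘ l i = l j).
{ intros i j a; destruct i, j; simpl in a |- *;
    solve [destruct a | apply comp_id_l | reflexivity | now symmetry]. }
destruct (Hc (Cone Hl)) as [u [Hu Uu]].
exists u; split.
- split; [exact (Hu cs_left) | exact (Hu cs_right)].
- intros u' [E1 E2]; apply Uu; intros j; destruct j; simpl.
  + exact E1.
  + exact E2.
  + change (r ∘ u' = f ∘ x).
    rewrite <- Hp, <- comp_assoc; now rewrite E1.
Qed.
End CospanDiagram.

Definition chosen_pullback (C : category) (HC : finitely_complete C)
    (X Y Z : C) (f : hom X Z) (g : hom Y Z) : pullback f g :=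
  epsilon (finitely_complete_pullback f g HC) (fun _ => True).

Section PullbackLift.
Variables (C : category) (X Y Z : C) (f : hom X Z) (g : hom Y Z).
Variable P : pullback f g.

Lemma pb_square : f ∘ pb_fst P = g ∘ pb_snd P.
Proof. exact (proj1 (pb_spec P)). Qed.

Lemma pb_lift_sig (Q : C) (x : hom Q X) (y : hom Q Y) (E : f ∘ x = g ∘ y) :
  {u : hom Q (pb_ob P) | pb_fst P ∘ u = x /\ pb_snd P ∘ u = y}.
Proof.
apply constructive_indefinite_description.
destruct (proj2 (pb_spec P) Q x y E) as [u [Hu _]]; now exists u.
Qed.

Definition pb_lift (Q : C) (x : hom Q X) (y : hom Q Y) (E : f ∘ x = g ∘ y) :
  hom Q (pb_ob P) := proj1_sig (pb_lift_sig E).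

Lemma pb_fst_lift (Q : C) (x : hom Q X) (y : hom Q Y) (E : f ∘ x = g ∘ y) :
  pb_fst P ∘ pb_lift E = x.
Proof. exact (proj1 (proj2_sig (pb_lift_sig E))). Qed.

Lemma pb_snd_lift (Q : C) (x : hom Q X) (y : hom Q Y) (E : f ∘ x = g ∘ y) :
  pb_snd P ∘ pb_lift E = y.
Proof. exact (proj2 (proj2_sig (pb_lift_sig E))). Qed.

Lemma pb_ext (Q : C) (u v : hom Q (pb_ob P)) :
  pb_fst P ∘ u = pb_fst P ∘ v -> pb_snd P ∘ u = pb_snd P ∘ v -> u = v.
Proof.
intros E1 E2.
assert (E : f ∘ (pb_fst P ∘ v) = g ∘ (pb_snd P ∘ v))
  by now rewrite !comp_assoc, pb_square.
destruct (proj2 (pb_spec P) Q _ _ E) as [w [_ Uw]].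
transitivity w; [symmetry|]; apply Uw; auto.
Qed.
End PullbackLift.

(** * Slices *)

Record slice_ob (C : category) (B : C) := SliceOb {
  sl_ob : C;
  sl_map : hom sl_ob B
}.

Record slice_hom (C : category) (B : C) (E F : slice_ob B) := SliceHom {
  sl_hom : hom (sl_ob E) (sl_ob F);
  sl_comm : sl_map F ∘ sl_hom = sl_map E
}.

Lemma slice_hom_eq (C : category) (B : C) (E F : slice_ob B)
    (f g : slice_hom E F) : sl_hom f = sl_hom g -> f = g.
Proof.
destruct f as [f Hf], g as [g Hg]; simpl; intros <-.
f_equal; apply proof_irrelevance.
Qed.

Program Definition slice (C : category) (B : C) : category :=
  @Category (slice_ob B) (@slice_hom C B)
    (fun E => @SliceHom C B E E (idm (sl_ob E)) _)
    (fun E F G g f => @SliceHom C B E G (sl_hom g ∘ sl_hom f) _) _ _ _.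
Next Obligation. apply comp_id_r. Qed.
Next Obligation. now rewrite comp_assoc, !sl_comm. Qed.
Next Obligation. apply slice_hom_eq, comp_id_l. Qed.
Next Obligation. apply slice_hom_eq, comp_id_r. Qed.
Next Obligation. apply slice_hom_eq, comp_assoc. Qed.

(** * Points and change of base *)

Record point (C : category) (B : C) := Point {
  pt_ob : C;
  pt_proj : hom pt_ob B;
  pt_sec : hom B pt_ob;
  pt_split : pt_proj ∘ pt_sec = idm B
}.

Record point_hom (C : category) (B : C) (E F : point B) := PointHom {
  pt_hom : hom (pt_ob E) (pt_ob F);
  pt_hom_proj : pt_proj F ∘ pt_hom = pt_proj E;
  pt_hom_sec : pt_hom ∘ pt_sec E = pt_sec F
}.

Lemma point_hom_eq (C : category) (B : C) (E F : point B)
    (f g : point_hom E F) : pt_hom f = pt_hom g -> f = g.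
Proof.
destruct f as [f Hf Hf'], g as [g Hg Hg']; simpl; intros <-.
f_equal; apply proof_irrelevance.
Qed.

Program Definition points (C : category) (B : C) : category :=
  @Category (point B) (@point_hom C B)
    (fun E => @PointHom C B E E (idm (pt_ob E)) _ _)
    (fun E F G g f => @PointHom C B E G (pt_hom g ∘ pt_hom f) _ _) _ _ _.
Next Obligation. apply comp_id_r. Qed.
Next Obligation. apply comp_id_l. Qed.
Next Obligation. now rewrite comp_assoc, !pt_hom_proj. Qed.
Next Obligation. now rewrite <- comp_assoc, !pt_hom_sec. Qed.
Next Obligation. apply point_hom_eq, comp_id_l. Qed.
Next Obligation. apply point_hom_eq, comp_id_r. Qed.
Next Obligation. apply point_hom_eq, comp_assoc. Qed.

Section ChangeOfBase.
Variables (C : category) (HC : finitely_complete C).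
Variables (Y X : C) (v : hom Y X).

Definition cob_pullback (E : point X) : pullback v (pt_proj E) :=
  chosen_pullback HC v (pt_proj E).

Lemma cob_sec_comm (E : point X) :
  v ∘ idm Y = pt_proj E ∘ (pt_sec E ∘ v).
Proof. now rewrite comp_assoc, pt_split, comp_id_l, comp_id_r. Qed.

Definition cob_ob (E : point X) : point Y :=
  @Point C Y (pb_ob (cob_pullback E)) (pb_fst (cob_pullback E))
    (pb_lift (cob_pullback E) (cob_sec_comm E))
    (pb_fst_lift (cob_pullback E) (cob_sec_comm E)).

Lemma cob_hom_comm (E F : point X) (f : point_hom E F) :
  v ∘ pb_fst (cob_pullback E)
  = pt_proj F ∘ (pt_hom f ∘ pb_snd (cob_pullback E)).
Proof. now rewrite comp_assoc, pt_hom_proj, pb_square. Qed.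

Program Definition cob_hom (E F : point X) (f : point_hom E F) :
    point_hom (cob_ob E) (cob_ob F) :=
  @PointHom C Y (cob_ob E) (cob_ob F)
    (pb_lift (cob_pullback F) (cob_hom_comm f))
    (pb_fst_lift (cob_pullback F) (cob_hom_comm f)) _.
Next Obligation.
apply pb_ext; rewrite comp_assoc.
- now rewrite !pb_fst_lift.
- now rewrite !pb_snd_lift, <- comp_assoc, pb_snd_lift, comp_assoc, pt_hom_sec.
Qed.

Program Definition change_of_base : functor (points X) (points Y) :=
  @Functor (points X) (points Y) cob_ob cob_hom _ _.
Next Obligation.
apply point_hom_eq, pb_ext; simpl; rewrite comp_id_r.
- apply pb_fst_lift.
- now rewrite pb_snd_lift, comp_id_l.
Qed.
Next Obligation.
apply point_hom_eq, pb_ext; simpl; rewrite comp_assoc.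
- now rewrite !pb_fst_lift.
- now rewrite !pb_snd_lift, <- !comp_assoc, pb_snd_lift.
Qed.
End ChangeOfBase.

Definition protomodular (C : category) : Prop :=
  exists HC : finitely_complete C,
  forall (Y X : C) (v : hom Y X), conservative (change_of_base HC v).

(** * Propointed categories *)

Definition extremal_epi (C : category) (X Y : C) (e : hom X Y) : Prop :=
  is_epi e /\
  forall (M : C) (m : hom M Y) (g : hom X M),
    is_mono m -> e = m ∘ g -> is_iso m.

Definition universal_extremal_epi (C : category) (X Y : C) (e : hom X Y) :
    Prop :=
  extremal_epi e /\
  forall (Z P : C) (f : hom Z Y) (p : hom P Z) (q : hom P X),
    is_pullback f e p q -> extremal_epi p.

Definition propointed (C : category) : Prop :=
  finitely_complete C /\
  exists (Z T : C) (e : hom Z T),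
    is_initial Z /\ is_terminal T /\ universal_extremal_epi e.

(* Main.v *)
(** For an initial object [0] with [0 -> 1] a universal extremal epimorphism,
    the functor [X |-> (X * 0 -> 0)] from [A] to [A/0] is right adjoint to the
    forgetful functor, and it is conservative: it preserves kernel pairs, so it
    suffices to treat monomorphisms, and a monomorphism [m : X -> Y] with
    [m * 0] invertible factors the extremal epimorphism [Y * 0 -> Y].  The
    category [A/0] is always pointed.  Conversely, a left-exact conservative
    functor reflects protomodularity, and when its codomain is pointed it sends
    [0 -> 1] to a split epimorphism; the pullbacks of [0 -> 1] are then sent to
    split epimorphisms too, hence are extremal epimorphisms. *)
From Stdlib Require Import ClassicalEpsilon List.
Require Import Defs.

Set Implicit Arguments.
Unset Strict Implicit.
Unset Printing Implicit Defensive.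

(** * Isomorphisms, initial and terminal objects *)

Lemma fmap_iso (C D : category) (F : functor C D) (X Y : C) (f : hom X Y) :
  is_iso f -> is_iso (fmap F f).
Proof.
intros [g [E1 E2]]; exists (fmap F g).
now rewrite <- !fmap_comp, E1, E2, !fmap_id.
Qed.

Lemma initial_ext (C : category) (Z : C) (HZ : is_initial Z) (X : C)
    (f g : hom Z X) : f = g.
Proof.
destruct (HZ X) as [h [_ H]]; transitivity h; [symmetry|]; now apply H.
Qed.

Lemma terminal_ext (C : category) (T : C) (HT : is_terminal T) (X : C)
    (f g : hom X T) : f = g.
Proof.
destruct (HT X) as [h [_ H]]; transitivity h; [symmetry|]; now apply H.
Qed.

Definition terminal_map (C : category) (T : C) (HT : is_terminal T) (X : C) :
  hom X T := proj1_sig (constructive_indefinite_description _ (HT X)).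

Lemma mono_split_epi_iso (C : category) (X Y : C) (m : hom X Y) (s : hom Y X) :
  is_mono m -> m ∘ s = idm Y -> is_iso m.
Proof.
intros Hm E; exists s; split; [|exact E].
apply Hm; now rewrite comp_assoc, E, comp_id_l, comp_id_r.
Qed.

(** * Limits *)

Definition empty_category : category :=
  @Category Empty_set (fun i _ => match i with end)
    (fun i => match i with end) (fun i => match i with end)
    (fun i => match i with end) (fun i => match i with end)
    (fun i => match i with end).

Lemma finite_empty : finite_category empty_category.
Proof. split; [exists nil; intros [] | intros []]. Qed.

Definition empty_diagram (C : category) : functor empty_category C.
Proof.
unshelve refine (@Functor empty_category C
  (fun i : Empty_set => match i with end) _ _ _); intros [].
Defined.

Definition empty_cone (C : category) (D : functor empty_category C) (X : C) :
  cone D.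
Proof.
unshelve refine (@Cone empty_category C D X _ _); intros [].
Defined.

(** The diagram [D] is kept arbitrary so that the lemma also covers
    [functor_comp F (empty_diagram C)], which is not convertible to [empty_diagram]. *)
Lemma empty_limit_terminal (C : category) (D : functor empty_category C)
    (c : cone D) : is_limit c <-> is_terminal (apex c).
Proof.
split.
- intros Hc X; destruct (Hc (empty_cone D X)) as [u [_ Hu]].
  exists u; split; [exact I|]; intros v _; apply Hu; intros [].
- intros HT c'; destruct (HT (apex c')) as [u [_ Hu]].
  exists u; split; [intros []|]; intros v _; now apply Hu.
Qed.

Lemma finitely_complete_terminal (C : category) :
  finitely_complete C -> exists T : C, is_terminal T.
Proof.
intros HC; destruct (HC _ finite_empty (empty_diagram C)) as [c Hc].
exists (apex c); now apply empty_limit_terminal.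
Qed.

Lemma left_exact_terminal (C D : category) (F : functor C D) (T : C) :
  left_exact F -> is_terminal T -> is_terminal (F T).
Proof.
intros HF HT.
assert (Hc : is_limit (empty_cone (empty_diagram C) T))
  by now apply empty_limit_terminal.
exact (proj1 (empty_limit_terminal _) (HF _ finite_empty _ _ Hc)).
Qed.

(** Weaker than left exactness on purpose: the forgetful functor of a slice has this property but
    need not preserve the terminal object. *)
Definition preserves_pullbacks (C D : category) (F : functor C D) : Prop :=
  forall (X Y Z P : C) (f : hom X Z) (g : hom Y Z) (p : hom P X) (q : hom P Y),
    is_pullback f g p q ->
    is_pullback (fmap F f) (fmap F g) (fmap F p) (fmap F q).

(** A pullback square is repackaged as a limit cone on the cospan, whose leg at the base is forced;
    the image cone is then unpacked again. *)
Lemma left_exact_preserves_pullbacks (C D : category) (F : functor C D) :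
  left_exact F -> preserves_pullbacks F.
Proof.
intros HF X Y Z P f g p q [E U].
pose (l := fun i : cospan_category =>
  match i return hom P (cospan_functor f g i) with
  | cs_left => p | cs_right => q | cs_base => f ∘ p end).
assert (Hl : forall (i j : cospan_category) (a : hom i j),
  fmap (cospan_functor f g) a ∘ l i = l j).
{ intros i j a; destruct i, j; simpl in a |- *;
    solve [destruct a | apply comp_id_l | reflexivity | now symmetry]. }
assert (Hc : is_limit (Cone Hl)).
{ intros c'; specialize (U (apex c') (leg c' cs_left) (leg c' cs_right)).
  pose proof (@leg_natural _ _ _ c' cs_left cs_base tt) as E1.
  pose proof (@leg_natural _ _ _ c' cs_right cs_base tt) as E2.
  simpl in E1, E2.
  destruct U as [u [[Hu1 Hu2] Hu]].
  { exact (eq_trans E1 (eq_sym E2)). }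
  exists u; split.
  - intros []; simpl; [exact Hu1 | exact Hu2 |].
    rewrite <- comp_assoc, Hu1; exact E1.
  - intros u' H; apply Hu; split; [exact (H cs_left) | exact (H cs_right)]. }
specialize (HF _ finite_cospan _ _ Hc).
split.
- now rewrite <- !fmap_comp, E.
- intros Q x y Exy.
  pose (l' := fun i : cospan_category =>
    match i return hom Q (functor_comp F (cospan_functor f g) i) with
    | cs_left => x | cs_right => y | cs_base => fmap F f ∘ x end).
  assert (Hl' : forall (i j : cospan_category) (a : hom i j),
    fmap (functor_comp F (cospan_functor f g)) a ∘ l' i = l' j).
  { intros i j a; destruct i, j; simpl in a |- *;
      solve [destruct a | now rewrite fmap_id, comp_id_l | reflexivity
            | now symmetry]. }
  destruct (HF (Cone Hl')) as [u [Hu Uu]]; exists u; split.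
  + split; [exact (Hu cs_left) | exact (Hu cs_right)].
  + intros u' [E1 E2]; apply Uu; intros []; simpl; [exact E1 | exact E2 |].
    now rewrite fmap_comp, <- comp_assoc, E1.
Qed.

(** A cone over the image of [G] transposes along the adjunction to a cone over [G]; the mediating
    map found there is transposed back. *)
Lemma right_adjoint_left_exact (C D : category) (R : functor D C) :
  right_adjoint R -> left_exact R.
Proof.
intros [L [adj]] J _ G c Hc c'.
assert (Hl : forall (i j : J) (a : hom i j),
  fmap G a ∘ (counit_at adj (G i) ∘ fmap L (leg c' i))
  = counit_at adj (G j) ∘ fmap L (leg c' j)).
{ intros i j a.
  rewrite comp_assoc, <- counit_natural, <- comp_assoc, <- fmap_comp.
  now rewrite <- (leg_natural c' a). }
destruct (Hc (Cone Hl)) as [u [Hu Uu]]; simpl in u, Hu, Uu.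
exists (fmap R u ∘ unit_at adj (apex c')); split.
- intros j; simpl.
  rewrite comp_assoc, <- fmap_comp, Hu, fmap_comp, <- comp_assoc.
  rewrite <- unit_natural, comp_assoc.
  change (fob (functor_comp R G) j) with (R (G j)).
  now rewrite triangle_right, comp_id_l.
- intros v Hv; simpl in v, Hv.
  (* Uniqueness: the transpose of [v] mediates the transposed cone, so it equals [u], and
     transposing back recovers [v]. *)
  rewrite (Uu (counit_at adj (apex c) ∘ fmap L v)).
  + now rewrite fmap_comp, <- comp_assoc, <- unit_natural, comp_assoc,
      triangle_right, comp_id_l.
  + intros j; rewrite comp_assoc, <- counit_natural, <- comp_assoc.
    now rewrite <- fmap_comp, Hv.
Qed.

(** Being a monomorphism is a pullback condition: the pair of identities is a kernel pair of [m]. *)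
Lemma preserves_mono (C D : category) (F : functor C D) (X Y : C)
    (m : hom X Y) :
  preserves_pullbacks F -> is_mono m -> is_mono (fmap F m).
Proof.
intros HF Hm W g h E.
assert (Hpb : is_pullback m m (idm X) (idm X)).
{ split; [reflexivity|]; intros Q x y Exy.
  exists x; split; [rewrite comp_id_l; split; [reflexivity | now apply Hm]|].
  intros u [Hu _]; now rewrite comp_id_l in Hu. }
destruct (proj2 (HF _ _ _ _ _ _ _ _ Hpb) W g h E) as [u [[E1 E2] _]].
rewrite fmap_id, comp_id_l in E1, E2; congruence.
Qed.

Lemma mono_of_equal_kernel_pair (C : category) (X Y K : C) (f : hom X Y)
    (k1 k2 : hom K X) : is_pullback f f k1 k2 -> k1 = k2 -> is_mono f.
Proof.
intros [_ U] E W g h Egh.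
destruct (U W g h Egh) as [u [[E1 E2] _]]; congruence.
Qed.

(* Applied to the diagonals [X -> X *_Y X], the hypothesis makes every [f] with
   [fmap F f] invertible a monomorphism. *)
Lemma conservative_from_monos (C D : category) (HC : finitely_complete C)
    (F : functor C D) :
  preserves_pullbacks F ->
  (forall (X Y : C) (m : hom X Y),
    is_mono m -> is_iso (fmap F m) -> is_iso m) ->
  conservative F.
Proof.
intros HF HM X Y f Hf; apply HM; [|exact Hf].
pose (K := chosen_pullback HC f f).
apply (mono_of_equal_kernel_pair (pb_spec K)).
pose (d := pb_lift K (eq_refl (f ∘ idm X))).
assert (d1 : pb_fst K ∘ d = idm X) by apply pb_fst_lift.
assert (d2 : pb_snd K ∘ d = idm X) by apply pb_snd_lift.
assert (Hd : is_mono d).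
{ intros W g h E; rewrite <- (comp_id_l g), <- (comp_id_l h), <- d1.
  now rewrite <- !comp_assoc, E. }
pose (FK := Build_pullback (HF _ _ _ _ _ _ _ _ (pb_spec K))).
(* Since [fmap F f] is left cancellable, the projections of its kernel pair coincide; this makes
   [fmap F (pb_fst K)] a two-sided inverse of [fmap F d]. *)
assert (E : fmap F (pb_fst K) = fmap F (pb_snd K)).
{ destruct Hf as [g [Hg _]].
  rewrite <- (comp_id_l (fmap F (pb_fst K))), <- Hg, <- comp_assoc.
  rewrite (pb_square FK
    : fmap F f ∘ fmap F (pb_fst K) = fmap F f ∘ fmap F (pb_snd K)).
  now rewrite comp_assoc, Hg, comp_id_l. }
assert (Hi : is_iso d).
{ apply HM; [exact Hd|].
  exists (fmap F (pb_fst K)); split; [now rewrite <- fmap_comp, d1, fmap_id|].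
  apply (@pb_ext _ _ _ _ _ _ FK); simpl; rewrite comp_assoc, <- fmap_comp.
  - now rewrite d1, fmap_id, comp_id_l, comp_id_r.
  - now rewrite d2, fmap_id, comp_id_l, comp_id_r. }
(* Both projections are retractions of the invertible [d], so both equal its inverse. *)
destruct Hi as [g [_ Hg]].
rewrite <- (comp_id_r (pb_fst K)), <- (comp_id_r (pb_snd K)), <- Hg.
now rewrite !comp_assoc, d1, d2.
Qed.

(** The equalizer is the pullback of the graphs of [f] and [g] in the product [P] of [Y] and [Z];
    comparing first components shows that its two projections agree. *)
Lemma finitely_complete_equalizer (C : category) (HC : finitely_complete C)
    (Y Z : C) (f g : hom Y Z) :
  exists (E : C) (m : hom E Y), is_mono m /\ f ∘ m = g ∘ m /\
    forall (W : C) (h : hom W Y), f ∘ h = g ∘ h -> exists k, h = m ∘ k.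
Proof.
destruct (finitely_complete_terminal HC) as [T HT].
pose (P := chosen_pullback HC (terminal_map HT Y) (terminal_map HT Z)).
pose (gr := fun k : hom Y Z => pb_lift P
  (terminal_ext HT (terminal_map HT Y ∘ idm Y) (terminal_map HT Z ∘ k))).
assert (gr1 : forall k, pb_fst P ∘ gr k = idm Y)
  by (intros k; apply pb_fst_lift).
assert (gr2 : forall k, pb_snd P ∘ gr k = k)
  by (intros k; apply pb_snd_lift).
pose (Q := chosen_pullback HC (gr f) (gr g)).
assert (Epq : pb_fst Q = pb_snd Q).
{ rewrite <- (comp_id_l (pb_fst Q)), <- (gr1 f), <- comp_assoc, pb_square.
  now rewrite comp_assoc, gr1, comp_id_l. }
exists (pb_ob Q), (pb_fst Q); split; [|split].
- intros W u v Euv; apply pb_ext; [exact Euv | now rewrite <- Epq].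
- transitivity (pb_snd P ∘ (gr f ∘ pb_fst Q)).
  + now rewrite comp_assoc, gr2.
  + now rewrite pb_square, comp_assoc, gr2, Epq.
- intros W h Eh.
  assert (E : gr f ∘ h = gr g ∘ h).
  { apply pb_ext; rewrite !comp_assoc; [now rewrite !gr1 | now rewrite !gr2]. }
  exists (pb_lift Q E); now rewrite pb_fst_lift.
Qed.

(** * Protomodularity *)

Lemma point_iso (C : category) (B : C) (E F : points B) (f : hom E F) :
  is_iso f <-> is_iso (pt_hom f).
Proof.
split.
- intros [g [E1 E2]]; exists (pt_hom g); split.
  + exact (f_equal (fun h => pt_hom h) E1).
  + exact (f_equal (fun h => pt_hom h) E2).
- intros [g [E1 E2]].
  assert (H1 : pt_proj E ∘ g = pt_proj F)
    by now rewrite <- (pt_hom_proj f), <- comp_assoc, E2, comp_id_r.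
  assert (H2 : g ∘ pt_sec F = pt_sec E)
    by now rewrite <- (pt_hom_sec f), comp_assoc, E1, comp_id_l.
  exists (PointHom H1 H2); split; now apply point_hom_eq.
Qed.

Lemma pullback_comparison (C : category) (X Y Z : C) (f : hom X Z)
    (g : hom Y Z) (P Q : pullback f g) :
  exists u : hom (pb_ob P) (pb_ob Q),
    is_iso u /\ pb_fst Q ∘ u = pb_fst P /\ pb_snd Q ∘ u = pb_snd P.
Proof.
exists (pb_lift Q (pb_square P)); split.
- exists (pb_lift P (pb_square Q)); split; apply pb_ext;
    rewrite comp_assoc, ?pb_fst_lift, ?pb_snd_lift;
    now rewrite ?pb_fst_lift, ?pb_snd_lift, comp_id_r.
- split; [apply pb_fst_lift | apply pb_snd_lift].
Qed.

Lemma iso_comp (C : category) (X Y Z : C) (g : hom Y Z) (f : hom X Y) :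
  is_iso g -> is_iso f -> is_iso (g ∘ f).
Proof.
intros [g' [G1 G2]] [f' [F1 F2]]; exists (f' ∘ g'); split.
- now rewrite <- comp_assoc, (comp_assoc g'), G1, comp_id_l.
- now rewrite <- comp_assoc, (comp_assoc f), F2, comp_id_l.
Qed.

(** Conservativity of change of base, freed from the chosen pullbacks: in this form the data can be
    transported along any functor that preserves pullbacks. *)
Definition reflects_point_isos (C : category) : Prop :=
  forall (Y X : C) (v : hom Y X) (E F : point X) (f : point_hom E F)
    (P : pullback v (pt_proj E)) (Q : pullback v (pt_proj F))
    (h : hom (pb_ob P) (pb_ob Q)),
    pb_fst Q ∘ h = pb_fst P -> pb_snd Q ∘ h = pt_hom f ∘ pb_snd P ->
    is_iso h -> is_iso (pt_hom f).

Lemma protomodularE (C : category) :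
  protomodular C <-> finitely_complete C /\ reflects_point_isos C.
Proof.
split.
- intros [HC H]; split; [exact HC|].
  intros Y X v E F f P Q h E1 E2 Hh.
  apply (@point_iso C X E F f), (H Y X v), point_iso; simpl.
  destruct (pullback_comparison (cob_pullback HC v E) P) as [u [Hu [U1 U2]]].
  destruct (pullback_comparison Q (cob_pullback HC v F)) as [w [Hw [W1 W2]]].
  (* The chosen change of base of [f] is [h] composed on both sides with the comparison isomorphisms
     between pullbacks. *)
  replace (pb_lift _ _) with (w ∘ (h ∘ u)).
  + apply iso_comp; [exact Hw | now apply iso_comp].
  + apply pb_ext; rewrite ?pb_fst_lift, ?pb_snd_lift, !comp_assoc.
    * now rewrite W1, E1, U1.
    * now rewrite W2, E2, <- comp_assoc, U2.
- intros [HC H]; exists HC; intros Y X v E F f Hf.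
  apply point_iso in Hf; apply point_iso.
  refine (H Y X v E F f _ _ _ _ _ Hf); [apply pb_fst_lift | apply pb_snd_lift].
Qed.

Definition map_point (C D : category) (G : functor C D) (X : C)
    (E : point X) : point (G X) :=
  @Point D (G X) (G (pt_ob E)) (fmap G (pt_proj E)) (fmap G (pt_sec E))
    (eq_trans (eq_sym (fmap_comp G (pt_proj E) (pt_sec E)))
      (eq_trans (f_equal (fun h => fmap G h) (pt_split E)) (fmap_id G X))).

(** The points, both pullbacks and the isomorphism [h] are all carried to [D] by [G]; there
    [fmap G (pt_hom f)] is invertible, and [G] reflects this. *)
Lemma reflects_protomodular (C D : category) (HC : finitely_complete C)
    (G : functor C D) :
  preserves_pullbacks G -> conservative G -> protomodular D -> protomodular C.
Proof.
intros HG HG' [_ HD]%protomodularE; apply protomodularE; split; [exact HC|].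
intros Y X v E F f P Q h E1 E2 Hh; apply HG'.
assert (H1 : pt_proj (map_point G F) ∘ fmap G (pt_hom f)
  = pt_proj (map_point G E)) by (simpl; now rewrite <- fmap_comp, pt_hom_proj).
assert (H2 : fmap G (pt_hom f) ∘ pt_sec (map_point G E)
  = pt_sec (map_point G F)) by (simpl; now rewrite <- fmap_comp, pt_hom_sec).
pose (GP := Build_pullback (HG _ _ _ _ _ _ _ _ (pb_spec P))
  : pullback (fmap G v) (pt_proj (map_point G E))).
pose (GQ := Build_pullback (HG _ _ _ _ _ _ _ _ (pb_spec Q))
  : pullback (fmap G v) (pt_proj (map_point G F))).
pose (Gf := @PointHom D (G X) (map_point G E) (map_point G F)
  (fmap G (pt_hom f)) H1 H2).
apply (HD _ _ (fmap G v) _ _ Gf GP GQ (fmap G h)); simpl.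
- now rewrite <- fmap_comp, E1.
- now rewrite <- !fmap_comp, E2.
- now apply fmap_iso.
Qed.

(** * Slices *)

Definition slice_forget (C : category) (B : C) : functor (slice B) C :=
  @Functor (slice B) C (fun E => sl_ob E) (fun E F f => sl_hom f)
    (fun _ => eq_refl) (fun _ _ _ _ _ => eq_refl).

Lemma slice_forget_conservative (C : category) (B : C) :
  conservative (slice_forget B).
Proof.
intros E F f [g [E1 E2]]; simpl in g, E1, E2.
assert (Hg : sl_map E ∘ g = sl_map F)
  by now rewrite <- (sl_comm f), <- comp_assoc, E2, comp_id_r.
exists (SliceHom Hg); split; now apply slice_hom_eq.
Qed.

Lemma slice_forget_preserves_pullbacks (C : category) (B : C) :
  preserves_pullbacks (slice_forget B).
Proof.
intros X Y Z P f g p q [E U]; split; simpl.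
- exact (f_equal (fun h => sl_hom h) E).
- intros Q x y Exy.
  (* The apex becomes an object over [B] through [X]; commutativity of the square then puts [y] over
     [B] too. *)
  pose (Q' := SliceOb (sl_map X ∘ x) : slice B).
  assert (Hy : sl_map Y ∘ y = sl_map Q').
  { simpl; rewrite <- (sl_comm g), <- (sl_comm f), <- !comp_assoc.
    now rewrite Exy. }
  pose (x' := @SliceHom C B Q' X x eq_refl : hom Q' X).
  pose (y' := @SliceHom C B Q' Y y Hy : hom Q' Y).
  destruct (U Q' x' y') as [u [[E1 E2] Uu]]; [now apply slice_hom_eq|].
  exists (sl_hom u); split.
  + split; [exact (f_equal (fun h => sl_hom h) E1)
           | exact (f_equal (fun h => sl_hom h) E2)].
  + intros w [W1 W2].
    assert (Hw : sl_map P ∘ w = sl_map Q')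
      by (simpl; now rewrite <- W1, comp_assoc, sl_comm).
    rewrite (Uu (@SliceHom C B Q' P w Hw)); [reflexivity|].
    split; now apply slice_hom_eq.
Qed.

(* [J] with a terminal object [None] freely adjoined: a diagram [J -> C/B] is a
   diagram on this category sending [None] to [B], and has the same limit. *)
Section AdjoinTerminal.
Variable J : category.

Definition top_hom (i j : option J) : Type :=
  match i, j with
  | Some i, Some j => hom i j
  | _, None => unit
  | None, Some _ => Empty_set
  end.

Definition top_id (i : option J) : top_hom i i :=
  match i with Some i => idm i | None => tt end.

Definition top_comp (i j k : option J) :
  top_hom j k -> top_hom i j -> top_hom i k.
Proof.
destruct i as [i|], j as [j|], k as [k|]; simpl; intros b a;
  solve [exact (b ∘ a) | exact tt | destruct a | destruct b].
Defined.

Definition top_category : category.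
Proof.
refine (@Category (option J) top_hom top_id top_comp _ _ _).
- intros [i|] [j|] f; simpl in *;
    solve [apply comp_id_l | now destruct f].
- intros [i|] [j|] f; simpl in *;
    solve [apply comp_id_r | now destruct f].
- intros [i|] [j|] [k|] [l|] h g f; simpl in *;
    solve [apply comp_assoc | reflexivity | destruct h | destruct g
          | destruct f].
Defined.

Lemma finite_top_category : finite_category J -> finite_category top_category.
Proof.
intros [[l Hl] H]; split.
- exists (None :: map Some l); intros [i|]; simpl; [right | now left].
  apply in_map, Hl.
- intros [i|] [j|]; simpl.
  + apply H.
  + exists (tt :: nil); intros []; now left.
  + exists nil; intros [].
  + exists (tt :: nil); intros []; now left.
Qed.

Variables (C : category) (B : C) (D : functor J (slice B)).

Definition top_fob (i : top_category) : C :=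
  match i with Some i => sl_ob (D i) | None => B end.

Definition top_fmap (i j : top_category) :
  @hom top_category i j -> hom (top_fob i) (top_fob j).
Proof.
destruct i as [i|], j as [j|]; simpl; intros a.
- exact (sl_hom (fmap D a)).
- exact (sl_map (D i)).
- destruct a.
- exact (idm B).
Defined.

Definition top_functor : functor top_category C.
Proof.
refine (@Functor top_category C top_fob top_fmap _ _).
- intros [i|]; simpl; [|reflexivity].
  exact (f_equal (fun h => sl_hom h) (fmap_id D i)).
- intros [i|] [j|] [k|] g f; simpl in g, f |- *;
    try solve [destruct f | destruct g].
  + exact (f_equal (fun h => sl_hom h) (fmap_comp D g f)).
  + symmetry; apply sl_comm.
  + symmetry; apply comp_id_l.
  + symmetry; apply comp_id_l.
Defined.

(** The leg at [None] is the structure map of the limit object, and naturality along the arrows into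
    [None] puts the other legs over [B]. Conversely the structure map of a cone in the slice serves
    as its leg at [None]. *)
Lemma slice_limit (c : cone top_functor) :
  is_limit c -> exists c' : cone D, is_limit c'.
Proof.
intros Hc.
pose (S := @SliceOb C B (apex c) (leg c None) : slice B).
pose (l := fun j : J => @SliceHom C B S (D j) (leg c (Some j))
  (@leg_natural _ _ _ c (Some j) None tt) : hom S (D j)).
assert (Hl : forall (i j : J) (a : hom i j), fmap D a ∘ l i = l j).
{ intros i j a; apply slice_hom_eq.
  exact (@leg_natural _ _ _ c (Some i) (Some j) a). }
exists (Cone Hl); intros d.
pose (k := fun i : top_category =>
  match i return hom (sl_ob (apex d)) (top_functor i) with
  | Some i => sl_hom (leg d i) | None => sl_map (apex d) end).
assert (Hk : forall (i j : top_category) (a : hom i j),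
  fmap top_functor a ∘ k i = k j).
{ intros [i|] [j|] a; simpl in a |- *.
  - exact (f_equal (fun h => sl_hom h) (leg_natural d a)).
  - apply sl_comm.
  - destruct a.
  - apply comp_id_l. }
destruct (Hc (Cone Hk)) as [u [Hu Uu]]; simpl in u, Hu, Uu.
exists (@SliceHom C B (apex d) S u (Hu None)); split.
- intros j; apply slice_hom_eq; exact (Hu (Some j)).
- intros w Hw; apply slice_hom_eq; simpl; apply Uu; intros [j|]; simpl.
  + exact (f_equal (fun h => sl_hom h) (Hw j)).
  + exact (sl_comm w).
Qed.
End AdjoinTerminal.

Lemma slice_finitely_complete (C : category) (B : C) :
  finitely_complete C -> finitely_complete (slice B).
Proof.
intros HC J HJ D.
destruct (HC _ (finite_top_category HJ) (top_functor D)) as [c Hc].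
exact (slice_limit Hc).
Qed.

Lemma slice_protomodular (C : category) (B : C) :
  protomodular C -> protomodular (slice B).
Proof.
intros HC.
apply (@reflects_protomodular _ _
  (slice_finitely_complete (B := B) (proj1 (proj1 (protomodularE C) HC)))
  (slice_forget B)); [| | exact HC].
- apply slice_forget_preserves_pullbacks.
- apply slice_forget_conservative.
Qed.

Lemma slice_initial_pointed (C : category) (Z : C) :
  is_initial Z -> pointed (slice Z).
Proof.
intros HZ; exists (SliceOb (idm Z)); split; intros E.
- destruct (HZ (sl_ob E)) as [f _].
  exists (@SliceHom C Z (SliceOb (idm Z)) E f (initial_ext HZ _ _)).
  split; [exact I|]; intros g _; apply slice_hom_eq, (initial_ext HZ).
- exists (@SliceHom C Z E (SliceOb (idm Z)) (sl_map E) (comp_id_l _)).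
  split; [exact I|]; intros g _; apply slice_hom_eq; simpl.
  rewrite <- (sl_comm g); apply comp_id_l.
Qed.

(** * The functor of product with [Z], valued in the slice over [Z] *)

Section ProductWith.
Variables (C : category) (HC : finitely_complete C).
Variables (Z T : C) (e : hom Z T) (HT : is_terminal T).

(** The product is presented as a pullback along [e], so that its first projection is a pullback of
    [e] and inherits extremality when [e] is universally extremal. *)
Definition prod_with (X : C) : pullback (terminal_map HT X) e :=
  chosen_pullback HC (terminal_map HT X) e.

Definition prod_with_map (X Y : C) (f : hom X Y) :
  hom (pb_ob (prod_with X)) (pb_ob (prod_with Y)) :=
  pb_lift (prod_with Y) (terminal_ext HT
    (terminal_map HT Y ∘ (f ∘ pb_fst (prod_with X)))
    (e ∘ pb_snd (prod_with X))).

Lemma prod_with_map_fst (X Y : C) (f : hom X Y) :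
  pb_fst (prod_with Y) ∘ prod_with_map f = f ∘ pb_fst (prod_with X).
Proof. apply pb_fst_lift. Qed.

Lemma prod_with_map_snd (X Y : C) (f : hom X Y) :
  pb_snd (prod_with Y) ∘ prod_with_map f = pb_snd (prod_with X).
Proof. apply pb_snd_lift. Qed.

Definition prod_functor : functor C (slice Z).
Proof.
refine (@Functor C (slice Z) (fun X => SliceOb (pb_snd (prod_with X)))
  (fun X Y f => @SliceHom C Z (SliceOb (pb_snd (prod_with X)))
    (SliceOb (pb_snd (prod_with Y))) (prod_with_map f) (prod_with_map_snd f))
  _ _).
- intros X; apply slice_hom_eq, pb_ext; simpl.
  + now rewrite prod_with_map_fst, comp_id_l, comp_id_r.
  + now rewrite prod_with_map_snd, comp_id_r.
- intros X Y W g f; apply slice_hom_eq, pb_ext; simpl; rewrite comp_assoc.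
  + now rewrite !prod_with_map_fst, <- !comp_assoc, prod_with_map_fst.
  + now rewrite !prod_with_map_snd.
Defined.

(** The unit [un] at an object over [Z] is the graph of its structure map; the counit is the first
    projection. *)
Lemma prod_functor_right_adjoint : right_adjoint prod_functor.
Proof.
exists (slice_forget Z); constructor.
pose (un := fun E : slice Z => pb_lift (prod_with (sl_ob E))
  (terminal_ext HT (terminal_map HT (sl_ob E) ∘ idm _) (e ∘ sl_map E))).
assert (un1 : forall E, pb_fst (prod_with (sl_ob E)) ∘ un E = idm (sl_ob E))
  by (intros E; apply pb_fst_lift).
assert (un2 : forall E, pb_snd (prod_with (sl_ob E)) ∘ un E = sl_map E)
  by (intros E; apply pb_snd_lift).
refine (@Build_adjunction (slice Z) C (slice_forget Z) prod_functor
  (fun E => @SliceHom C Z E (prod_functor (sl_ob E)) (un E) (un2 E))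
  (fun X => pb_fst (prod_with X)) _ _ _ _).
- intros E F f; apply slice_hom_eq, pb_ext; simpl; rewrite !comp_assoc.
  + now rewrite un1, prod_with_map_fst, <- comp_assoc, un1, comp_id_l,
      comp_id_r.
  + now rewrite un2, prod_with_map_snd, un2, sl_comm.
- intros X Y f; apply prod_with_map_fst.
- intros E; apply un1.
- intros X; apply slice_hom_eq, pb_ext; simpl; rewrite comp_assoc, comp_id_r.
  + rewrite prod_with_map_fst, <- comp_assoc.
    exact (eq_trans (f_equal (fun h => pb_fst (prod_with X) ∘ h)
      (un1 (SliceOb (pb_snd (prod_with X))))) (comp_id_r _)).
  + rewrite prod_with_map_snd.
    apply (un2 (SliceOb (pb_snd (prod_with X)))).
Qed.

Lemma prod_functor_conservative :
  universal_extremal_epi e -> conservative prod_functor.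
Proof.
intros [_ He]; apply (conservative_from_monos HC).
- apply left_exact_preserves_pullbacks, right_adjoint_left_exact,
    prod_functor_right_adjoint.
- intros X Y m Hm Hi.
  apply (fmap_iso (slice_forget Z)) in Hi; destruct Hi as [g [_ Hg]].
  simpl in g, Hg.
  destruct (He _ _ _ _ _ (pb_spec (prod_with Y))) as [_ Hext].
  (* With [g] inverse to the product of [m] with [Z], the first projection of [prod_with Y] factors
     through [m]. *)
  apply (Hext X m (pb_fst (prod_with X) ∘ g) Hm).
  now rewrite comp_assoc, <- prod_with_map_fst, <- comp_assoc, Hg, comp_id_r.
Qed.
End ProductWith.

(** * Extremal epimorphisms *)

(** If [p] factors through a monomorphism [m], then [fmap F m] is a monomorphism with a section,
    hence invertible, and [F] reflects this. *)
Lemma extremal_epi_of_split_image (C D : category) (HC : finitely_complete C)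
    (F : functor C D) (X Y : C) (p : hom X Y) (s : hom (F Y) (F X)) :
  preserves_pullbacks F -> conservative F -> fmap F p ∘ s = idm (F Y) ->
  extremal_epi p.
Proof.
intros HF HF' Es.
assert (Hext : forall (M : C) (m : hom M Y) (g : hom X M),
  is_mono m -> p = m ∘ g -> is_iso m).
{ intros M m g Hm E; apply HF', (mono_split_epi_iso (s := fmap F g ∘ s)).
  - now apply preserves_mono.
  - now rewrite comp_assoc, <- fmap_comp, <- E. }
split; [|exact Hext].
(* Extremality yields the epimorphism property: [p] factors through the equalizer of [f] and [g],
   which is therefore invertible. *)
intros Z f g E.
destruct (finitely_complete_equalizer HC f g) as [K [m [Hm [Em Um]]]].
destruct (Um _ p E) as [k Hk].
destruct (Hext _ m k Hm Hk) as [i [_ Hi]].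
now rewrite <- (comp_id_r f), <- (comp_id_r g), <- Hi, !comp_assoc, Em.
Qed.

(** The section is induced by the identity and [s ∘ fmap F f]: in [D], split epimorphisms are stable
    under pullback. *)
Lemma split_image_pullback (C D : category) (F : functor C D)
    (X Y Z P : C) (f : hom Z Y) (e : hom X Y) (p : hom P Z) (q : hom P X)
    (s : hom (F Y) (F X)) :
  preserves_pullbacks F -> fmap F e ∘ s = idm (F Y) ->
  is_pullback f e p q ->
  exists t : hom (F Z) (F P), fmap F p ∘ t = idm (F Z).
Proof.
intros HF Es HP.
destruct (proj2 (HF _ _ _ _ _ _ _ _ HP) (F Z) (idm _) (s ∘ fmap F f))
  as [t [[Ht _] _]].
- now rewrite comp_assoc, Es, comp_id_l, comp_id_r.
- now exists t.
Qed.

Lemma propointed_of_left_exact (C D : category) (HC : finitely_complete C)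
    (F : functor C D) :
  has_initial C -> pointed D -> left_exact F -> conservative F ->
  propointed C.
Proof.
intros [Z HZ] [O [HO HO']] HF HF'; split; [exact HC|].
destruct (finitely_complete_terminal HC) as [T HT].
destruct (HZ T) as [e _]; exists Z, T, e; split; [exact HZ|].
split; [exact HT|].
pose proof (left_exact_terminal HF HT) as HFT.
pose proof (left_exact_preserves_pullbacks HF) as HFP.
destruct (HO (F Z)) as [z _].
(* The section goes through the zero object [O]; it splits [fmap F e] because endomorphisms of the
   terminal object [F T] are trivial. *)
pose (s := z ∘ terminal_map HO' (F T)).
assert (Es : fmap F e ∘ s = idm (F T)) by apply (terminal_ext HFT).
split; [now apply (extremal_epi_of_split_image HC (s := s) HFP HF')|].
intros W P f p q HP.
destruct (split_image_pullback HFP Es HP) as [t Ht].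
now apply (extremal_epi_of_split_image HC (s := t) HFP HF').
Qed.

Lemma left_adjoint_initial (C D : category) (L : functor C D)
    (R : functor D C) (adj : adjunction L R) (Z : C) :
  is_initial Z -> is_initial (L Z).
Proof.
intros HZ X; destruct (HZ (R X)) as [f _].
exists (counit_at adj X ∘ fmap L f); split; [exact I|]; intros g _.
(* By initiality [f] is the transpose of any [g], so transposing back gives [g]. *)
rewrite (initial_ext HZ f (fmap R g ∘ unit_at adj Z)), fmap_comp.
now rewrite comp_assoc, counit_natural, <- comp_assoc, triangle_left,
  comp_id_r.
Qed.

Theorem proposition4p1 (A : category) (HA : finitely_complete A) :
  let P1 := propointed A /\ protomodular A in
  let P2 := propointed A /\
    forall Z : A, is_initial Z -> protomodular (slice Z) in
  let P3 := exists (X : category) (U : functor A X),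
    (finitely_complete X /\ pointed X /\ protomodular X) /\
    conservative U /\ right_adjoint U in
  let P4 := has_initial A /\
    exists (X : category) (U : functor A X),
      (finitely_complete X /\ pointed X /\ protomodular X) /\
      left_exact U /\ conservative U in
  (P1 <-> P2) /\ (P2 <-> P3) /\ (P3 <-> P4).
Proof.
intros P1 P2 P3 P4.
assert (H12 : P1 -> P2).
{ intros [HP HM]; split; [exact HP|]; intros Z _.
  now apply slice_protomodular. }
assert (H23 : P2 -> P3).
(* [P2] concerns every initial object, in particular the source [Z] of the universal extremal
   epimorphism [e]. *)
{ intros [[_ [Z [T [e [HZ [HT He]]]]]] HM].
  exists (slice Z), (prod_functor HA e HT); split; [split; [|split]|split].
  - now apply slice_finitely_complete.
  - now apply slice_initial_pointed.
  - now apply HM.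
  - now apply prod_functor_conservative.
  - apply prod_functor_right_adjoint. }
assert (H34 : P3 -> P4).
{ intros [X [U [HX [HU HR]]]]; split.
  (* The left adjoint sends the zero object of [X] to an initial object of [A]. *)
  - destruct HR as [L [adj]], HX as [_ [[O [HO _]] _]].
    exists (L O); exact (left_adjoint_initial adj HO).
  - exists X, U; repeat split; try apply HX; [|exact HU].
    now apply right_adjoint_left_exact. }
assert (H41 : P4 -> P1).
{ intros [HI [X [U [[_ [HX HM]] [HU HU']]]]]; split.
  - now apply (propointed_of_left_exact HA (F := U)).
  - apply (reflects_protomodular HA (G := U)); [|exact HU' | exact HM].
    now apply left_exact_preserves_pullbacks. }
tauto.
Qed.
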